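(* Let $a>0$ be a real number. Then $$\psi(a) = \int_{0}^{\infty} \left( \frac{e^{-x}}{x} - \frac{e^{-ax}}{1-e^{-x}} \right) dx.$$
   Context: $\psi$ denotes the digamma function, $\psi(x) = \frac{d}{dx}\log\Gamma(x) = \Gamma'(x)/\Gamma(x)$, where $\Gamma(x)=\int_0^\infty t^{x-1}e^{-t}\,dt$ for $x>0$. *)

(* Defs.v *)
From HB Require Import structures.
From mathcomp Require Import all_boot all_order all_algebra.
From mathcomp Require Import all_classical all_reals all_analysis.

Set Implicit Arguments.
Unset Strict Implicit.
Unset Printing Implicit Defensive.

Import Order.TTheory GRing.Theory Num.Theory.
Import numFieldNormedType.Exports.

Local Open Scope classical_set_scope.
Local Open Scope ring_scope.

(* Meaningful for 0 < x only: for x <= 0 the integral diverges, and [Rintegral]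
   then returns 0. *)
Definition Gamma (R : realType) (x : R) : R :=
  \int[lebesgue_measure]_(t in `]0, +oo[) (t `^ (x - 1) * expR (- t)).

Definition digamma (R : realType) (x : R) : R :=
  derive1 (fun y : R => ln (Gamma y)) x.

(* Main.v *)
Require Import Defs.
From HB Require Import structures.
From mathcomp Require Import all_boot all_order all_algebra.
From mathcomp Require Import all_classical all_reals all_analysis.
From mathcomp Require Import measurable_realfun ring lra.

Import Order.TTheory GRing.Theory Num.Theory.
Import numFieldNormedType.Exports.

Local Open Scope classical_set_scope.
Local Open Scope ring_scope.

(** Write f for [ln \o Gamma] and g a for the integral on the right-hand side.
The proof compares f and g through their behaviour under the shift by 1, in
the spirit of the Bohr-Mollerup theorem, so that Gamma is never differentiated
under the integral sign.

On the side of g: splitting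
  [exp(-x)/x - exp(-ax)/(1 - exp(-x))
   = (exp(-x) - exp(-ax))/x - exp(-ax) (1/(1 - exp(-x)) - 1/x)]
turns the first half into Frullani's integral [ln a] ([frullani]); the
second half has a weight between 0 and 1, so that its integral lies between 0
and [1/a] and depends continuously on a.  Hence g is continuous with
[ln a - 1/a <= g a <= ln a].  Moreover [g (a + 1) - g a] is the integral of
[exp(-ax)], that is [1/a].

On the side of f: integration by parts gives [f (a + 1) = ln a + f a], and
integrating the tangent-line inequality for the concave function [t^h] at
[t = a] gives [f (a + h) - f a <= h ln a] for h in [0, 1]
([ln_Gamma_sub_le]), a consequence of log-convexity that selects f among the
solutions of this equation.

Both functions thus satisfy compatible recurrences and the same logarithmic
asymptotics.  The defects [f (a + h) - f a - h g a] and
[h g (a + h) - (f (a + h) - f a)] do not increase under [a -> a + 1] and their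
lower limit along the shifts is nonnegative, so they are nonnegative:
  [h g a <= f (a + h) - f a <= h g (a + h)].
As g is continuous, f is differentiable with derivative g
([recurrence_is_derive]). *)

(** * Derivatives from two-sided slope bounds *)

Section Calculus.
Context {R : realType}.
Implicit Types (F phi : R -> R) (a b x y : R).

(** The difference quotient at a lies between the values of phi at the two ends
of the increment, which merge by continuity. *)
Lemma is_derive_slope_squeeze F phi a : 0 < a -> {for a, continuous phi} ->
  (forall x y, 0 < x -> x < y -> y <= x + 1 ->
     phi x * (y - x) <= F y - F x <= phi y * (y - x)) ->
  is_derive a (1 : R) F (phi a).
Proof.
move=> a0 cphi slope; apply/is_derive1_caratheodory.
exists (fun z => if z == a then phi a else (F z - F a) / (z - a)); split.
- move=> z; have [->|za] := eqVneq z a; first by rewrite !subrr mulr0.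
  by rewrite divfK// subr_eq0.
- apply/cvgrPdist_le => e e0.
  move/cvgrPdist_le : cphi => /(_ e e0) cphi; near=> z; rewrite eqxx.
  have [_|za] := eqVneq z a; first by rewrite subrr normr0 ltW.
  have z0 : 0 < z by near: z; exact: lt_nbhsr.
  have z1 : `|a - z| < 1.
    by near: z; apply: (@cvgr_dist_lt _ R^o) => //; exact: cvg_id.
  move: z1; rewrite ltr_norml => /andP[z1 z2].
  have : `|phi a - phi z| <= e by near: z.
  rewrite ler_norml => /andP[e1 e2].
  have [az|{}az] := ltP a z.
  - have /andP[] := slope _ _ a0 az (ltac:(lra)).
    have d0 : 0 < z - a by lra.
    rewrite -(ler_pdivlMr _ _ d0) -(ler_pdivrMr _ _ d0) ler_norml => ? ?.
    by apply/andP; split; lra.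
  - have {}az : z < a by rewrite lt_neqAle za.
    have /andP[] := slope _ _ z0 az (ltac:(lra)).
    have d0 : 0 < a - z by lra.
    rewrite -(ler_pdivlMr _ _ d0) -(ler_pdivrMr _ _ d0) ler_norml -(opprB z a).
    rewrite invrN mulrN -mulNr opprB => ? ?.
    by apply/andP; split; lra.
- by rewrite eqxx.
Unshelve. all: end_near. Qed.

Lemma ln_sub_bounds a b : 0 < a -> 0 < b ->
  (b - a) / b <= ln b - ln a <= (b - a) / a.
Proof.
move=> a0 b0; rewrite -ln_div ?posrE//.
have ub (x y : R) : 0 < x -> 0 < y -> ln (y / x) <= (y - x) / x.
  move=> x0 y0; have -> : (y - x) / x = y / x - 1 by field; rewrite gt_eqF.
  have /le_ln1Dx : -1 < y / x - 1 by have := divr_gt0 y0 x0; lra.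
  by rewrite addrC subrK.
apply/andP; split; last exact: ub.
have := ub b a b0 a0.
rewrite -(invf_div b a) lnV ?posrE ?divr_gt0//.
by rewrite -(opprB b a) mulNr lerN2.
Qed.

(** Stated for functions with the derivative of the logarithm on the positive
half-line only; composing with the exponential moves the problem to the whole
line, where a function with zero derivative is constant. *)
Lemma ln_unique F : F 1 = 0 ->
  (forall x, 0 < x -> is_derive x (1 : R) F x^-1) ->
  forall x, 0 < x -> F x = ln x.
Proof.
move=> F1 dF x x0.
have dG (s : R) : is_derive s (1 : R) (fun s => F (expR s) - s) 0.
  have dFe : is_derive s (1 : R) (F \o expR) 1.
    rewrite -[X in is_derive _ _ _ X](mulVf (lt0r_neq0 (expR_gt0 s))).
    exact: is_derive1_comp (dF _ (expR_gt0 s)) (is_derive_expR s).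
  by rewrite -[0](subrr 1); exact: is_deriveB.
have /eqP := @is_derive_0_is_cst _ _ (ln x) 0 dG.
by rewrite lnK ?posrE// expR0 F1 subrr subr_eq0 => /eqP.
Qed.

End Calculus.

(** * Frullani's integral for the logarithm *)

Section LaplaceIntegrals.
Context {R : realType}.
Notation mu := (@lebesgue_measure R).
Implicit Types a b x y : R.

Local Notation pos := (`]0, +oo[%classic : set R).

Lemma pos_mem x : pos x -> 0 < x.
Proof. by rewrite /= in_itv/= andbT. Qed.

Lemma measurable_inv_pos : measurable_fun pos (GRing.inv : R -> R).
Proof.
apply: open_continuous_measurable_fun; first exact: interval_open.
by move=> x /set_mem/pos_mem x0; apply: inv_continuous; rewrite gt_eqF.
Qed.

Lemma measurable_expRM a : measurable_fun setT (fun x => expR (- (a * x))).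
Proof.
by do 2!apply: measurableT_comp => //.
Qed.

Lemma integral_expRM a : 0 < a ->
  (\int[mu]_(x in pos) (expR (- (a * x)))%:E = (a^-1)%:E)%E.
Proof.
move=> a0; rewrite integral_itv_obnd_cbnd; last first.
  by apply/measurable_EFinP; apply: measurable_funTS; exact: measurable_expRM.
have /(congr1 (fun z => a^-1%:E * z)%E) := integral_exponential_pdf a0.
rewrite mule1 => <-.
rewrite -ge0_integralZl//; last 3 first.
- by apply/measurable_EFinP; exact: measurable_exponential_pdf.
- by move=> x _; rewrite lee_fin exponential_pdf_ge0// ltW.
- by rewrite lee_fin invr_ge0 ltW.
rewrite [LHS]integral_mkcond; apply: eq_integral => x _.
rewrite /exponential_pdf !patchE; case: ifPn => _; last by rewrite mule0.
by rewrite -EFinM mulKf ?gt_eqF// mulNr.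
Qed.

Lemma integrable_expRM a : 0 < a ->
  mu.-integrable pos (EFin \o (fun x => expR (- (a * x)))).
Proof.
move=> a0; apply/integrableP; split.
  by apply/measurable_EFinP; apply: measurable_funTS; exact: measurable_expRM.
under eq_integral do rewrite /= ger0_norm ?expR_ge0//.
by rewrite integral_expRM// ltry.
Qed.

Lemma integrable_scaled_expRM c a : 0 < a ->
  mu.-integrable pos (EFin \o (fun x => c * expR (- (a * x)))).
Proof.
move=> a0.
by apply: (eq_integrable _ _ _ _ (integrableZl _ c (integrable_expRM a a0))).
Qed.

Lemma Rintegral_expRM a : 0 < a ->
  \int[mu]_(x in pos) expR (- (a * x)) = a^-1.
Proof. by move=> a0; rewrite /Rintegral integral_expRM. Qed.

Lemma le_integrable_pos (f g : R -> R) : measurable_fun pos f ->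
  mu.-integrable pos (EFin \o g) ->
  (forall x, 0 < x -> 0 <= f x <= g x) -> mu.-integrable pos (EFin \o f).
Proof.
move=> mf ig fg; apply: le_integrable ig => //; first exact/measurable_EFinP.
move=> x /pos_mem x0 /=; rewrite lee_fin.
by have /andP[f0 ?] := fg _ x0; rewrite !ger0_norm// (le_trans f0).
Qed.

(** The mean value inequality for [exp(- s x)] as s runs from a to b, in the form
that bounds Frullani's integrand by integrable exponentials. *)
Lemma expR_diff_bounds a b x : 0 < x -> a <= b ->
  (b - a) * expR (- (b * x)) <= (expR (- (a * x)) - expR (- (b * x))) / x
    <= (b - a) * expR (- (a * x)).
Proof.
move=> x0 ab; rewrite ler_pdivlMr// ler_pdivrMr//; apply/andP; split.
- have -> : - (a * x) = - (b * x) + (b - a) * x by ring.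
  rewrite expRD; have := expR_ge1Dx ((b - a) * x).
  have := expR_ge0 (- (b * x)); nra.
- have -> : - (b * x) = - (a * x) + - ((b - a) * x) by ring.
  rewrite expRD; have := expR_ge1Dx (- ((b - a) * x)).
  have := expR_ge0 (- (a * x)); nra.
Qed.

Lemma measurable_frullani a b :
  measurable_fun pos (fun x => (expR (- (a * x)) - expR (- (b * x))) / x).
Proof.
apply: measurable_funM; last exact: measurable_inv_pos.
by apply: measurable_funB; apply: measurable_funTS; exact: measurable_expRM.
Qed.

Lemma integrable_frullani a b : 0 < a -> 0 < b ->
  mu.-integrable pos
    (EFin \o (fun x => (expR (- (a * x)) - expR (- (b * x))) / x)).
Proof.
wlog ab : a b / a <= b.
  move=> H a0 b0; have [ab|/ltW ba] := leP a b; first exact: H.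
  apply: eq_integrable (integrableN (H _ _ ba b0 a0)) => // x _ /=.
  by rewrite /= -mulNr opprB.
move=> a0 b0.
apply: (@le_integrable_pos _ (fun x => (b - a) * expR (- (a * x)))).
- exact: measurable_frullani.
- exact: integrable_scaled_expRM.
- move=> x x0; have /andP[lo ->] := expR_diff_bounds _ _ _ x0 ab.
  by rewrite andbT; apply: le_trans lo; rewrite mulr_ge0 ?expR_ge0// subr_ge0.
Qed.

(** As a function of a, the integral has increments between [(b - a)/b] and
[(b - a)/a] by [expR_diff_bounds], hence derivative [1/a]; it vanishes at 1. *)
Lemma frullani a : 0 < a ->
  \int[mu]_(x in pos) ((expR (- (1 * x)) - expR (- (a * x))) / x) = ln a.
Proof.
pose J a := \int[mu]_(x in pos) ((expR (- (1 * x)) - expR (- (a * x))) / x).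
have J_sub x y : 0 < x -> 0 < y ->
    J y - J x = \int[mu]_(t in pos) ((expR (- (x * t)) - expR (- (y * t))) / t).
  move=> x0 y0; rewrite /J -RintegralB//; try exact: integrable_frullani.
  by apply: eq_Rintegral => t _; rewrite -mulrBl; congr (_ / _); ring.
have J_bounds x y : 0 < x -> x < y -> y <= x + 1 ->
    - x^-1 * (y - x) <= - J y - - J x <= - y^-1 * (y - x).
  move=> x0 xy _; have y0 : 0 < y by exact: lt_trans xy.
  have bnd z : 0 < z -> z^-1 * (y - x) =
      \int[mu]_(t in pos) ((y - x) * expR (- (z * t))).
    move=> z0. rewrite RintegralZl; last 2 first.
    - exact: measurable_itv.
    - exact: integrable_expRM.
    by rewrite Rintegral_expRM// mulrC.
  (* [is_derive_slope_squeeze] asks for a nondecreasing slope, whence the sign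
     change: -J has slope [- 1/a]. *)
  have -> : - J y - - J x = - (J y - J x) by rewrite opprB opprK addrC.
  rewrite !mulNr !lerN2 (bnd x)// (bnd y)// J_sub//.
  apply/andP; split; apply: le_Rintegral => //;
    by [exact: integrable_scaled_expRM|exact: integrable_frullani|move=> t /pos_mem t0;
      have /andP[] := expR_diff_bounds _ _ _ t0 (ltW xy)].
apply: (ln_unique J).
- rewrite /J -[RHS](mul0r (fine (mu pos))) -Rintegral_cst//.
  by apply: eq_Rintegral => t _; rewrite subrr mul0r.
- move=> x x0; have -> : J = - (fun y => - J y) by apply/funext => y /=; rewrite opprK.
  rewrite -[x^-1]opprK; apply: is_deriveN.
  apply: (is_derive_slope_squeeze _ (fun x => - x^-1)) => //.
  by apply: continuousN; apply: inv_continuous; rewrite gt_eqF.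
Qed.
End LaplaceIntegrals.

(** * Gauss' integral *)

Section GaussIntegral.
Context {R : realType}.
Notation mu := (@lebesgue_measure R).
Implicit Types a b x y : R.

Local Notation pos := (`]0, +oo[%classic : set R).

(** Up to sign, the kernel of Binet's formula for the digamma function, which
expresses its difference with [ln] as a Laplace transform. *)
Definition binet_weight x : R := (1 - expR (- x))^-1 - x^-1.

Definition binet_integral a : R :=
  \int[mu]_(x in pos) (expR (- (a * x)) * binet_weight x).

Definition gauss_psi a : R :=
  \int[mu]_(x in pos) (expR (- x) / x - expR (- (a * x)) / (1 - expR (- x))).

Lemma binet_weight_bounds x : 0 < x -> 0 <= binet_weight x <= 1.
Proof.
move=> x0; rewrite /binet_weight.
have e1 : 0 < 1 - expR (- x) by rewrite subr_gt0 expR_lt1 oppr_lt0.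
apply/andP; split.
- by rewrite subr_ge0 lef_pV2 ?posrE//; have := expR_ge1Dx (- x); lra.
- have -> : (1 - expR (- x))^-1 - x^-1 =
      1 - (1 - (1 + x) * expR (- x)) / (x * (1 - expR (- x))).
    by field; rewrite !gt_eqF.
  rewrite lerBlDr lerDl divr_ge0//; last by rewrite mulr_ge0 ?ltW.
  by rewrite subr_ge0 expRN ler_pdivrMr ?expR_gt0// mul1r expR_ge1Dx.
Qed.

Lemma measurable_binet a :
  measurable_fun pos (fun x => expR (- (a * x)) * binet_weight x).
Proof.
apply: measurable_funM.
  by apply: measurable_funTS; exact: measurable_expRM.
apply: measurable_funB; last exact: measurable_inv_pos.
apply: open_continuous_measurable_fun; first exact: interval_open.
move=> x /set_mem/pos_mem x0.
have c1 : {for x, continuous (fun x => 1 - expR (- x))}.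
  apply: continuousB; first exact: cst_continuous.
  by apply: continuous_comp; [exact: continuousN|exact: continuous_expR].
apply: continuousV c1.
by rewrite gt_eqF// subr_gt0 expR_lt1 oppr_lt0.
Qed.

Lemma binet_integrand_bounds a x : 0 < x ->
  0 <= expR (- (a * x)) * binet_weight x <= expR (- (a * x)).
Proof.
move=> /binet_weight_bounds/andP[w0 w1].
by rewrite mulr_ge0 ?expR_ge0//= ler_piMr ?expR_ge0.
Qed.

Lemma integrable_binet a : 0 < a ->
  mu.-integrable pos (EFin \o (fun x => expR (- (a * x)) * binet_weight x)).
Proof.
move=> a0; apply: le_integrable_pos (integrable_expRM _ a0) _.
- exact: measurable_binet.
- by move=> x; exact: binet_integrand_bounds.
Qed.

Lemma binet_integral_bounds a : 0 < a -> 0 <= binet_integral a <= a^-1.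
Proof.
move=> a0; apply/andP; split.
  apply: Rintegral_ge0 => x /pos_mem x0.
  by have /andP[] := binet_integrand_bounds a _ x0.
rewrite -Rintegral_expRM//; apply: le_Rintegral => //.
- exact: integrable_binet.
- exact: integrable_expRM.
- by move=> x /pos_mem x0; have /andP[] := binet_integrand_bounds a _ x0.
Qed.

(** As the weight is at most 1, increments of the integral in a are dominated by
those of the unweighted integral [1/a]; continuity in a follows from this. *)
Lemma binet_integral_sub_bounds a b : 0 < a -> a <= b ->
  0 <= binet_integral a - binet_integral b <= a^-1 - b^-1.
Proof.
move=> a0 ab; have b0 : 0 < b by exact: lt_le_trans ab.
have ia := integrable_binet _ a0; have ib := integrable_binet _ b0.
have ea := integrable_expRM _ a0; have eb := integrable_expRM _ b0.
have [mD ieB] : measurable pos /\ mu.-integrable pos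
    (EFin \o (fun x => expR (- (a * x)) - expR (- (b * x)))).
  split; first exact: measurable_itv.
  by apply: (eq_integrable _ _ _ _ (integrableB _ ea eb)).
have iwB : mu.-integrable pos (EFin \o (fun x =>
    expR (- (a * x)) * binet_weight x - expR (- (b * x)) * binet_weight x)).
  by apply: (eq_integrable _ _ _ _ (integrableB _ ia ib)).
have key x : 0 < x ->
    0 <= expR (- (a * x)) * binet_weight x - expR (- (b * x)) * binet_weight x
      <= expR (- (a * x)) - expR (- (b * x)).
  move=> x0; have /andP[w0 w1] := binet_weight_bounds _ x0.
  have : expR (- (b * x)) <= expR (- (a * x)).
    by rewrite ler_expR lerN2 ler_pM2r.
  by rewrite -mulrBl -subr_ge0 => d0; rewrite mulr_ge0//= ler_piMr.
rewrite /binet_integral -(Rintegral_expRM _ a0) -(Rintegral_expRM _ b0).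
rewrite -!RintegralB//; apply/andP; split.
- by apply: Rintegral_ge0 => x /pos_mem /key /andP[].
- by apply: le_Rintegral => // x /pos_mem /key /andP[].
Qed.

(** Neither term of Gauss' integrand is integrable near 0.  Exchanging [1/x]
against [1/(1 - exp(-x))] at the cost of the bounded weight leaves two
separately integrable terms. *)
Lemma gauss_integrandE a x :
  expR (- x) / x - expR (- (a * x)) / (1 - expR (- x)) =
  (expR (- (1 * x)) - expR (- (a * x))) / x - expR (- (a * x)) * binet_weight x.
Proof. by rewrite /binet_weight mul1r; ring. Qed.

Lemma integrable_gauss_psi a : 0 < a -> mu.-integrable pos (EFin \o (fun x =>
  expR (- x) / x - expR (- (a * x)) / (1 - expR (- x)))).
Proof.
move=> a0.
have i1 := integrable_frullani _ _ (@ltr01 R) a0.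
have i2 := integrable_binet _ a0.
apply: (eq_integrable _ _ _ _ (integrableB _ i1 i2)) => // x _ /=.
by rewrite gauss_integrandE.
Qed.

Lemma gauss_psiE a : 0 < a -> gauss_psi a = ln a - binet_integral a.
Proof.
move=> a0; rewrite -(frullani _ a0) -RintegralB//.
- by apply: eq_Rintegral => x _; rewrite gauss_integrandE.
- exact: integrable_frullani.
- exact: integrable_binet.
Qed.

(** The difference of the two integrands is
[(exp(-ax) - exp(-(a+1)x))/(1 - exp(-x)) = exp(-ax)]. *)
Lemma gauss_psiD1 a : 0 < a -> gauss_psi (a + 1) = gauss_psi a + a^-1.
Proof.
move=> a0; have a10 : 0 < a + 1 by rewrite addr_gt0.
suff <- : gauss_psi (a + 1) - gauss_psi a = a^-1.
  by rewrite [RHS]addrC subrK.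
rewrite /gauss_psi -RintegralB//; try exact: integrable_gauss_psi.
rewrite -[RHS]Rintegral_expRM//; apply: eq_Rintegral => x /set_mem/pos_mem x0.
have -> : - ((a + 1) * x) = - (a * x) + - x by ring.
rewrite expRD; field.
by rewrite !gt_eqF// subr_gt0 expR_lt1 oppr_lt0.
Qed.

Lemma gauss_psi_ln_bounds a : 0 < a ->
  ln a - a^-1 <= gauss_psi a <= ln a.
Proof.
move=> a0; rewrite gauss_psiE//.
have /andP[k0 k1] := binet_integral_bounds _ a0.
by apply/andP; split; lra.
Qed.

Lemma continuous_gauss_psi a : 0 < a -> {for a, continuous gauss_psi}.
Proof.
move=> a0.
have dist b : 0 < b ->
    `|binet_integral a - binet_integral b| <= `|a^-1 - b^-1|.
  move=> b0; wlog ab : a b a0 b0 / a <= b.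
    move=> H; have [|/ltW] := leP a b; first exact: H.
    by rewrite distrC (distrC a^-1); exact: H.
  have /andP[d0 d1] := binet_integral_sub_bounds _ _ a0 ab.
  by rewrite !ger0_norm// (le_trans d0).
have cbinet : {for a, continuous binet_integral}.
  apply/cvgrPdist_le => e e0.
  have /cvgrPdist_le/(_ e e0) cV : {for a, continuous (@GRing.inv R)}.
    by apply: inv_continuous; rewrite gt_eqF.
  near=> b; apply: le_trans (dist b _) _; last by near: b.
  by near: b; exact: lt_nbhsr.
have clnB : ln x - binet_integral x @[x --> a] --> gauss_psi a.
  by rewrite gauss_psiE//; apply: cvgB => //; exact: continuous_ln.
apply: cvg_trans clnB; apply: near_eq_cvg; near=> b.
by rewrite gauss_psiE//; near: b; exact: lt_nbhsr.
Unshelve. all: end_near. Qed.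

End GaussIntegral.

(** * The functional equation and growth of Gamma *)

Section GammaFunction.
Context {R : realType}.
Notation mu := (@lebesgue_measure R).
Implicit Types p x y h t : R.

Local Notation pos := (`]0, +oo[%classic : set R).

(** Raise [t/(2p) <= exp(t/(2p))] to the power p. *)
Lemma powR_le_expR p t : 0 < p -> 0 <= t ->
  t `^ p <= (2 * p) `^ p * expR (2^-1 * t).
Proof.
move=> p0 t0; have p20 : 0 < 2 * p by rewrite mulr_gt0.
have -> : t `^ p = (2 * p) `^ p * (t / (2 * p)) `^ p.
  rewrite -powRM ?(ltW p20) ?divr_ge0 ?(ltW p20)//.
  by rewrite [X in _ = X `^ _]mulrC divfK// gt_eqF.
rewrite ler_pM2l ?powR_gt0//.
have -> : expR (2^-1 * t) = expR (t / (2 * p)) `^ p.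
  by rewrite -expRM; congr expR; field; rewrite gt_eqF.
apply: ge0_ler_powR; rewrite ?nnegrE ?expR_ge0 ?divr_ge0 ?(ltW p0) ?(ltW p20)//.
by have := expR_ge1Dx (t / (2 * p)); lra.
Qed.

Lemma powR_expRN_le p t : 0 < p -> 0 <= t ->
  t `^ p * expR (- t) <= (2 * p) `^ p * expR (- (2^-1 * t)).
Proof.
move=> p0 t0; have -> : - (2^-1 * t) = 2^-1 * t + - t by field.
by rewrite expRD mulrA ler_wpM2r ?expR_ge0// powR_le_expR.
Qed.

Lemma powR_expRN_cvg_pinfty p : 0 < p ->
  (n.+2%:R : R) `^ p * expR (- n.+2%:R) @[n --> \oo] --> 0.
Proof.
move=> p0; pose C := (2 * p) `^ p * 2.
apply: (@squeeze_cvgr _ _ _ _ (fun=> 0) (fun n => C * n.+1%:R^-1)).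
- near=> n; rewrite mulr_ge0 ?powR_ge0 ?expR_ge0//=.
  apply: le_trans (powR_expRN_le _ _ p0 _) _; first exact: ler0n.
  rewrite /C -mulrA ler_wpM2l ?powR_ge0//.
  rewrite expRN -[leRHS]invf_div lef_pV2 ?posrE ?expR_gt0 ?divr_gt0//.
  have := expR_ge1Dx (2^-1 * n.+2%:R : R).
  have -> : (n.+2%:R : R) = n.+1%:R + 1 by rewrite -natr1.
  lra.
- exact: cvg_cst.
- rewrite -[0](mulr0 C); apply: cvgM; first exact: cvg_cst.
  exact: cvg_harmonic.
Unshelve. all: end_near. Qed.

Lemma powR_expRN_cvg0 p : 0 < p ->
  (n.+2%:R^-1 : R) `^ p * expR (- n.+2%:R^-1) @[n --> \oo] --> 0.
Proof.
move=> p0.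
apply: (@squeeze_cvgr _ _ _ _ (fun=> 0) (fun n => n.+2%:R^-1 `^ p)).
- near=> n; rewrite mulr_ge0 ?powR_ge0 ?expR_ge0//=.
  by rewrite ler_piMr ?powR_ge0// expR_le1 oppr_le0 invr_ge0.
- exact: cvg_cst.
- have /cvg_at_rightP := powR_cvg0 p0; apply; split=> [n|].
    by rewrite invr_gt0.
  by have := @cvg_harmonic R; rewrite -(cvg_shiftn 1); under eq_fun do rewrite addn1.
Unshelve. all: end_near. Qed.

Definition Gamma_integrand p t : R := t `^ (p - 1) * expR (- t).

Lemma measurable_Gamma_integrand p (D : set R) :
  measurable_fun D (Gamma_integrand p).
Proof.
apply: measurable_funTS; apply: measurable_funM; first exact: measurable_powR.
by apply: measurableT_comp.
Qed.

Lemma Gamma_integrand_ge0 p t : 0 <= Gamma_integrand p t.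
Proof. by rewrite mulr_ge0 ?powR_ge0 ?expR_ge0. Qed.

(** Integration by parts on a segment that avoids 0, where [t^(p-1)] may be
unbounded. *)
Lemma Gamma_segment p x y : 0 < p -> 0 < x -> x < y ->
  (\int[mu]_(t in `[x, y]) (Gamma_integrand (p + 1) t)%:E =
   (x `^ p * expR (- x) - y `^ p * expR (- y))%:E +
   p%:E * \int[mu]_(t in `[x, y]) (Gamma_integrand p t)%:E)%E.
Proof.
move=> p0 x0 xy.
have gt0 t : t \in `[x, y] -> 0 < t.
  by rewrite in_itv/= => /andP[xt _]; exact: lt_le_trans xt.
have gt0' t : t \in `]x, y[ -> 0 < t.
  by move/subset_itv_oo_cc; exact: gt0.
have dexp (t : R) : is_derive t (1 : R) (fun t => - expR (- t)) (expR (- t)).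
  have h : is_derive t (1 : R) (expR \o -%R) (expR (- t) * -1).
    exact: is_derive1_comp.
  by have := is_deriveN h; rewrite mulrN1 opprK.
have cexp : continuous (fun t : R => expR (- t)).
  by move=> t; apply: continuous_comp; [exact: continuousN|exact: continuous_expR].
have cpow q t : 0 < t -> {for t, continuous (fun t : R => t `^ q)}.
  by move=> t0; apply/differentiable_continuous/derivable1_diffP;
    apply: derivable_powR; rewrite in_itv/= andbT.
have y0 : 0 < y by exact: lt_trans xy.
have := @integration_by_parts R (fun t => t `^ p) (fun t => - expR (- t))
  (fun t => p * t `^ (p - 1)) (fun t => expR (- t)) x y xy.
rewrite /Gamma_integrand addrK => ->.
- rewrite -ge0_integralZl//; last 3 first.
  + by apply/measurable_EFinP; exact: measurable_Gamma_integrand.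
  + by move=> t _; rewrite lee_fin; exact: Gamma_integrand_ge0.
  + by rewrite lee_fin ltW.
  congr (_ + _)%E; first by congr EFin; ring.
  rewrite -[RHS]oppeK; congr (- _)%E; rewrite -integral_ge0N.
    by apply: eq_integral => t _; rewrite -EFinM -EFinN; congr EFin; ring.
  by move=> t _; rewrite -EFinM lee_fin mulr_ge0 ?(ltW p0)// Gamma_integrand_ge0.
- apply: continuous_in_subspaceT => t /set_mem/gt0 t0.
  by apply: cvgM; [exact: cvg_cst|exact: cpow].
- split; last 2 first.
  + exact/cvg_at_right_filter/cpow.
  + exact/cvg_at_left_filter/cpow.
  by move=> t /gt0' t0; apply: derivable_powR; rewrite in_itv/= andbT.
- by move=> t /gt0' t0; rewrite powR_derive1// in_itv/= andbT.
- exact: continuous_subspaceT.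
- split.
  + by move=> t _; have [] := dexp t.
  + by apply: cvg_at_right_filter; apply: cvgN; exact: cexp.
  + by apply: cvg_at_left_filter; apply: cvgN; exact: cexp.
- by move=> t _; rewrite derive1E; have [] := dexp t.
Qed.

(* The index is shifted by 2 so that the endpoints are distinct already for
   n = 0. *)
Local Notation seg n := (`[n.+2%:R^-1, n.+2%:R]%classic : set R).

Lemma pos_bigcup_segments : \bigcup_n seg n = pos.
Proof.
apply/seteqP; split => [t [n _]|t] /=; rewrite !in_itv/= andbT.
  by move=> /andP[+ _]; apply: lt_le_trans; rewrite invr_gt0.
move=> t0.
have [n hn] : exists n : nat, Num.max t t^-1 <= n%:R.
  by exists (Num.bound (Num.max t t^-1)); apply/ltW/archi_boundP; rewrite le_max ltW.
have {}hn : Num.max t t^-1 <= n.+2%:R.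
  by apply: le_trans hn _; rewrite ler_nat -addn2 leq_addr.
exists n => //=; rewrite in_itv/=; move: hn; rewrite ge_max => /andP[-> h].
by rewrite andbT -[t]invrK lef_pV2 ?posrE// invr_gt0.
Qed.

Lemma Gamma_segments_cvg p :
  (\int[mu]_(t in seg n) (Gamma_integrand p t)%:E)%E
    @[n --> \oo] --> (\int[mu]_(t in pos) (Gamma_integrand p t)%:E)%E.
Proof.
rewrite -pos_bigcup_segments; apply: ge0_nondecreasing_set_cvg_integral.
- move=> m n mn; rewrite subsetEset; apply: subset_itv; rewrite bnd_simp.
    by rewrite lef_pV2 ?posrE// ler_nat !ltnS.
  by rewrite ler_nat !ltnS.
- by move=> n; exact: measurable_itv.
- by move=> n; apply/measurable_EFinP; exact: measurable_Gamma_integrand.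
- by move=> n t _; rewrite lee_fin Gamma_integrand_ge0.
Qed.

(** The functional equation in the extended reals, where monotone convergence
applies to both sides before either integral is known to be finite.  It then
yields the integrability for exponents p in ]0, 1[ from that for p + 1. *)
Lemma integral_Gamma_integrandD1 p : 0 < p ->
  (\int[mu]_(t in pos) (Gamma_integrand (p + 1) t)%:E =
   p%:E * \int[mu]_(t in pos) (Gamma_integrand p t)%:E)%E.
Proof.
move=> p0; pose b n : R := n.+2%:R.
pose r n := (b n)^-1 `^ p * expR (- (b n)^-1) - b n `^ p * expR (- b n).
have r0 : (r n)%:E @[n --> \oo] --> (0%:E : \bar R).
  apply: cvg_EFin; first exact: nearW.
  rewrite -[0](subrr 0); apply: cvgB.
    exact: powR_expRN_cvg0.
  exact: powR_expRN_cvg_pinfty.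
have := Gamma_segments_cvg (p + 1).
have -> : (fun n => \int[mu]_(t in seg n)
      (Gamma_integrand (p + 1) t)%:E)%E =
    (fun n => (r n)%:E + p%:E *
      \int[mu]_(t in seg n) (Gamma_integrand p t)%:E)%E.
  apply/funext => n; rewrite Gamma_segment// ?invr_gt0//.
  by apply: (@lt_trans _ _ 1); rewrite ?invf_lt1 ?ltr1n.
move=> cvg1.
have cvg2 : (p%:E * \int[mu]_(t in seg n) (Gamma_integrand p t)%:E)%E
    @[n --> \oo] --> (p%:E * \int[mu]_(t in pos) (Gamma_integrand p t)%:E)%E.
  by apply: cvgeZl => //; exact: Gamma_segments_cvg.
have cvg3 := cvgeD (fin_num_adde_defr _ (isT : 0%:E \is a fin_num)) r0 cvg2.
rewrite add0e in cvg3.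
by have -> := cvg_unique _ cvg1 (cvg3 _).
Qed.

(** For p + 1 the integrand is below a multiple of [exp(-t/2)]; the
functional equation brings finiteness down to p, where the integrand may be
singular at 0. *)
Lemma integrable_Gamma_integrand p : 0 < p ->
  mu.-integrable pos (EFin \o Gamma_integrand p).
Proof.
move=> p0.
have /integrableP[_ fin1] : mu.-integrable pos (EFin \o Gamma_integrand (p + 1)).
  apply: (le_integrable_pos _ (fun t => (2 * p) `^ p * expR (- (2^-1 * t)))).
  - exact: measurable_Gamma_integrand.
  - by apply: integrable_scaled_expRM.
  - move=> t t0; rewrite Gamma_integrand_ge0 /Gamma_integrand addrK.
    by rewrite powR_expRN_le// ltW.
apply/integrableP; split.
  by apply/measurable_EFinP; exact: measurable_Gamma_integrand.
have abseE q : (\int[mu]_(t in pos) `|(EFin \o Gamma_integrand q) t| =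
    \int[mu]_(t in pos) (Gamma_integrand q t)%:E)%E.
  by apply: eq_integral => t _; rewrite /= ger0_norm// Gamma_integrand_ge0.
move: fin1; rewrite !abseE integral_Gamma_integrandD1//.
have : (0 <= \int[mu]_(t in pos) (Gamma_integrand p t)%:E)%E.
  by apply: integral_ge0 => t _; rewrite lee_fin Gamma_integrand_ge0.
case: (\int[mu]_(t in pos) _)%E => [r| |] // _; first by rewrite !ltry.
by rewrite gt0_muley ?lte_fin// ltxx.
Qed.

Lemma GammaD1 p : 0 < p -> Gamma (p + 1) = p * Gamma p.
Proof.
move=> p0; rewrite /Gamma /Rintegral -[p * _]/(fine p%:E * _) -fineM//.
- by rewrite -integral_Gamma_integrandD1.
- exact: (integrable_fin_num _ (integrable_Gamma_integrand _ p0)).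
Qed.

(** The integrand is bounded below by a positive constant on [1, 2]. *)
Lemma Gamma_gt0 p : 0 < p -> 0 < Gamma p.
Proof.
move=> p0; pose c := expR (- `|p - 1| - 2).
have lb t : 1 <= t -> t <= 2 -> c <= Gamma_integrand p t.
  move=> t1 t2; have t0 : 0 < t by lra.
  rewrite /Gamma_integrand /powR gt_eqF// -expRD ler_expR lerD ?lerN2//.
  have l0 : 0 <= ln t by exact: ln_ge0.
  have l1 : ln t <= 1.
    have := @le_ln1Dx R (t - 1) (ltac:(lra)).
    by rewrite addrC subrK; lra.
  have := ler_norm (- (p - 1)); rewrite normrN; have := normr_ge0 (p - 1); nra.
have s12 : (`[1, 2]%classic : set R) `<=` pos.
  by move=> t /=; rewrite !in_itv/= andbT => /andP[+ _]; apply: lt_le_trans.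
rewrite /Gamma /Rintegral fine_gt0//; apply/andP; split; last first.
  exact: integrable_lty (integrable_Gamma_integrand _ p0).
apply: (@lt_le_trans _ _
  (\int[mu]_(t in `[1%R, 2%R]) (Gamma_integrand p t)%:E)%E); last first.
  apply: ge0_subset_integral => //.
  - by apply/measurable_EFinP; exact: measurable_Gamma_integrand.
  - by move=> t _; rewrite lee_fin Gamma_integrand_ge0.
apply: (@lt_le_trans _ _ (\int[mu]_(t in `[1%R, 2%R]) c%:E)%E).
  rewrite integral_cst//= lebesgue_measure_itv/= lte_fin ltr1n/= -EFinD -EFinM lte_fin.
  by rewrite mulr_gt0 ?expR_gt0// subr_gt0 ltr1n.
apply: ge0_le_integral => //.
- by move=> t _; rewrite lee_fin expR_ge0.
- by apply/measurable_EFinP; exact: measurable_Gamma_integrand.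
- by move=> t /=; rewrite in_itv/= => /andP[t1 t2]; rewrite lee_fin lb.
Qed.

(** Concavity of [t^h]: its graph lies below the tangent line at c. *)
Lemma powR_le_tangent h c t : 0 <= h -> h <= 1 -> 0 < c -> 0 < t ->
  t `^ h <= c `^ h * (1 - h + h * (t / c)).
Proof.
move=> h0 h1 c0 t0; have u0 : 0 < t / c by exact: divr_gt0.
have -> : t `^ h = c `^ h * (t / c) `^ h.
  by rewrite -powRM ?ltW// [X in _ = X `^ _]mulrC divfK// gt_eqF.
(* With [L = ln (t/c)], divide by [exp(h L)] and bound both exponentials below
   by their tangents at 0: the terms linear in L cancel. *)
rewrite ler_pM2l ?powR_gt0//; move: (t / c) u0 => u u0.
rewrite {1}/powR gt_eqF//; set L := ln u.
have uE : u = expR L by rewrite lnK.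
have e1 := expR_ge1Dx ((1 - h) * L); have e2 := expR_ge1Dx (- (h * L)).
have m0 := expR_gt0 (h * L).
have -> : 1 - h + h * u = expR (h * L) *
    ((1 - h) * expR (- (h * L)) + h * expR ((1 - h) * L)).
  rewrite mulrDr !(mulrCA (expR (h * L))) -!expRD subrr expR0 mulr1.
  by rewrite -mulrDl [h + _]addrC subrK mul1r -uE.
by rewrite ler_peMr ?(ltW m0)//; nra.
Qed.

(** Integrating the tangent bound at [c = y] against the integrand of [Gamma y]:
since [Gamma (y + 1) / y = Gamma y], the two terms of the tangent line
recombine into [y^h Gamma y], as Hölder's inequality would give. *)
Lemma Gamma_le_powR y h : 0 < y -> 0 <= h -> h <= 1 ->
  Gamma (y + h) <= y `^ h * Gamma y.
Proof.
move=> y0 h0 h1.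
have i0 := integrable_Gamma_integrand _ y0.
have y10 : 0 < y + 1 by rewrite addr_gt0.
have i1 := integrable_Gamma_integrand _ y10.
have ih : mu.-integrable pos (EFin \o Gamma_integrand (y + h)).
  by apply: integrable_Gamma_integrand; rewrite ltr_wpDr.
have -> : y `^ h * Gamma y =
    \int[mu]_(t in pos) (y `^ h * (1 - h) * Gamma_integrand y t +
                          y `^ h * (h / y) * Gamma_integrand (y + 1) t).
  rewrite RintegralD//; last 2 first.
  - by apply: (eq_integrable _ _ _ _ (integrableZl _ (y `^ h * (1 - h)) i0)).
  - by apply: (eq_integrable _ _ _ _ (integrableZl _ (y `^ h * (h / y)) i1)).
  rewrite !RintegralZl// -/(Gamma y) -/(Gamma (y + 1)) GammaD1//.
  by field; rewrite gt_eqF.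
apply: le_Rintegral => //.
  apply: (eq_integrable _ _ _ _ (integrableD _
    (integrableZl _ (y `^ h * (1 - h)) i0)
    (integrableZl _ (y `^ h * (h / y)) i1))) => //.
move=> t /pos_mem t0; rewrite -/(Gamma_integrand (y + h) t).
have E : Gamma_integrand (y + h) t = t `^ h * Gamma_integrand y t.
  rewrite /Gamma_integrand mulrA -powRD ?(gt_eqF t0) ?implybT//.
  by congr (_ `^ _ * _); ring.
have E1 : Gamma_integrand (y + 1) t = t * Gamma_integrand y t.
  by rewrite /Gamma_integrand addrK mulrA mulr_powRB1 // ltW.
rewrite E E1 [leRHS](_ : _ = y `^ h * (1 - h + h * (t / y)) * Gamma_integrand y t).
  by rewrite ler_wpM2r ?Gamma_integrand_ge0// powR_le_tangent.
by ring.
Qed.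

Lemma ln_Gamma_sub_le y h : 0 < y -> 0 <= h -> h <= 1 ->
  ln (Gamma (y + h)) - ln (Gamma y) <= h * ln y.
Proof.
move=> y0 h0 h1; have yh0 : 0 < y + h by rewrite ltr_wpDr.
rewrite lerBlDr -ln_powR -lnM ?posrE ?powR_gt0 ?Gamma_gt0//.
by rewrite ler_ln ?posrE ?mulr_gt0 ?powR_gt0 ?Gamma_gt0// Gamma_le_powR.
Qed.

Lemma ln_GammaD1 y : 0 < y -> ln (Gamma (y + 1)) = ln y + ln (Gamma y).
Proof. by move=> y0; rewrite GammaD1// lnM ?posrE ?Gamma_gt0. Qed.

End GammaFunction.

(** * Solutions of the difference equation and the digamma function *)

Section Digamma.
Context {R : realType}.
Implicit Types a x h : R.

(** The values at [x + n] stay below [u x] while their lower bounds [- 1/(x + n)]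
tend to 0. *)
Lemma shift_nonincreasing_ge0 (u : R -> R) x : 0 < x ->
  (forall y, 0 < y -> u (y + 1) <= u y) ->
  (forall y, 0 < y -> - y^-1 <= u y) -> 0 <= u x.
Proof.
move=> x0 decr lb.
have iter n : u (x + n%:R) <= u x.
  elim: n => [|n IHn]; first by rewrite addr0.
  rewrite -natr1 addrA; apply: le_trans IHn; apply: decr.
  by rewrite ltr_wpDr.
rewrite leNgt; apply/negP; rewrite -oppr_gt0 => d0.
pose n := Num.bound (- u x)^-1.
have n_gt : (- u x)^-1 < n%:R by apply: archi_boundP; rewrite invr_ge0 ltW.
have xn0 : 0 < x + n%:R by rewrite ltr_wpDr.
have : - u x <= (x + n%:R)^-1.
  by rewrite lerNl; exact: le_trans (lb _ xn0) (iter n).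
rewrite leNgt -[X in _ < X]invrK ltf_pV2 ?posrE ?invr_gt0//.
by rewrite (lt_trans n_gt)// ltrDr.
Qed.

(* In this section f plays the role of [ln \o Gamma] and g that of its
   derivative; f_le is the consequence of convexity that selects [ln \o Gamma]
   among the solutions of the functional equation. *)
Section Recurrence.
Context (f g : R -> R).
Context (fD1 : forall y, 0 < y -> f (y + 1) = ln y + f y).
Context (f_le : forall y h, 0 < y -> 0 <= h -> h <= 1 ->
  f (y + h) - f y <= h * ln y).
Context (gD1 : forall y, 0 < y -> g (y + 1) = g y + y^-1).
Context (g_ln : forall y, 0 < y -> ln y - y^-1 <= g y <= ln y).

(** Under the shift, the increment of f over h changes by [ln (1 + h/y) <= h/y], the change
of [h g].  The bound at infinity applies f_le to the complementary step
[1 - h] from [y + h] to [y + 1]. *)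
Lemma recurrence_slope_ge x h : 0 < x -> 0 <= h -> h <= 1 ->
  h * g x <= f (x + h) - f x.
Proof.
move=> x0 h0 h1; rewrite -subr_ge0.
apply: (@shift_nonincreasing_ge0 (fun y => f (y + h) - f y - h * g y)) => //
  y y0; have yh0 : 0 < y + h by rewrite ltr_wpDr.
- have /andP[_] := ln_sub_bounds _ _ y0 yh0.
  by rewrite (addrAC y 1 h) !fD1// gD1// [y + h - y]addrAC subrr add0r; lra.
- have f_ge : ln y - (1 - h) * ln (y + h) <= f (y + h) - f y.
    have := f_le (y + h) (1 - h) yh0 (ltac:(lra)) (ltac:(lra)).
    have -> : y + h + (1 - h) = y + 1 by ring.
    by rewrite fD1//; lra.
  have /andP[_ g1] := g_ln _ y0.
  have /andP[_] := ln_sub_bounds _ _ y0 yh0.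
  rewrite [y + h - y]addrAC subrr add0r => l1.
  have V0 : 0 < y^-1 by rewrite invr_gt0.
  nra.
Qed.

(** The mirror image of [recurrence_slope_ge]: now [ln (1 + h/y) >= h/(y + h)],
the change of [h g (y + h)]. *)
Lemma recurrence_slope_le x h : 0 < x -> 0 <= h -> h <= 1 ->
  f (x + h) - f x <= h * g (x + h).
Proof.
move=> x0 h0 h1; rewrite -subr_ge0.
apply: (@shift_nonincreasing_ge0 (fun y => h * g (y + h) - (f (y + h) - f y)))
  => // y y0; have yh0 : 0 < y + h by rewrite ltr_wpDr.
- have /andP[+ _] := ln_sub_bounds _ _ y0 yh0.
  by rewrite (addrAC y 1 h) !fD1// gD1// [y + h - y]addrAC subrr add0r; lra.
- have f1 := f_le _ _ y0 h0 h1.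
  have /andP[g1 _] := g_ln _ yh0.
  have l1 : ln y <= ln (y + h) by rewrite ler_ln ?posrE// lerDl.
  have V0 : 0 < (y + h)^-1 by rewrite invr_gt0.
  have V1 : (y + h)^-1 <= y^-1 by rewrite lef_pV2 ?posrE// lerDl.
  nra.
Qed.

Lemma recurrence_is_derive a : 0 < a -> {for a, continuous g} ->
  is_derive a (1 : R) f (g a).
Proof.
move=> a0 cg; apply: is_derive_slope_squeeze => // x y x0 xy yx1.
have h0 : 0 <= y - x by rewrite subr_ge0 ltW.
have h1 : y - x <= 1 by rewrite lerBlDr addrC.
have lo := recurrence_slope_ge x (y - x) x0 h0 h1.
have hi := recurrence_slope_le x (y - x) x0 h0 h1.
have yE : x + (y - x) = y by rewrite addrC subrK.
by rewrite yE in lo hi; rewrite ![_ * (y - x)]mulrC lo.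
Qed.

End Recurrence.

Lemma digammaE a : 0 < a -> digamma a = gauss_psi a.
Proof.
move=> a0; rewrite /digamma derive1E.
suff H : is_derive a (1 : R) (fun y => ln (Gamma y)) (gauss_psi a).
  by have [] := H.
apply: (recurrence_is_derive _ _ _ _ _ _ _ a0).
- exact: ln_GammaD1.
- exact: ln_Gamma_sub_le.
- exact: gauss_psiD1.
- exact: gauss_psi_ln_bounds.
- exact: continuous_gauss_psi.
Qed.

End Digamma.

Theorem proposition2p12 (R : realType) (a : R) (ha : 0 < a) :
  ((digamma a)%:E =
   \int[lebesgue_measure]_(x in `]0%R, +oo[)
     (expR (- x) / x - expR (- (a * x)) / (1 - expR (- x)))%:E)%E.
Proof.
rewrite digammaE// /gauss_psi /Rintegral fineK//.
exact: (integrable_fin_num _ (integrable_gauss_psi _ ha)).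
Qed.
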